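(* Let $R$ be a ring that is a finite-dimensional algebra over each of two fields $k_1$ and $k_2$. Then $R$ is a symmetric $k_1$-algebra if and only if $R$ is a symmetric $k_2$-algebra. That is, the property of a finite-dimensional $k$-algebra $R$ being a symmetric $k$-algebra is independent of $k$.
   Context: Rings are associative with identity. A ring $R$ is an algebra over a field $k$ via a unital ring homomorphism $k \to Z(R)$ into the center of $R$; no relation between $k_1$ and $k_2$ is assumed. For a finite-dimensional $k$-algebra $R$, the $k$-dual $\hat R = \mathrm{Hom}_k(R,k)$ is an $(R,R)$-bimodule via $(rf)(s) = f(sr)$ and $(fr)(s) = f(rs)$. $R$ is a symmetric $k$-algebra if $R \simeq \hat R$ as $(R,R)$-bimodules; equivalently, there is a $k$-linear functional $\lambda : R \to k$ whose kernel contains no nonzero left ideal and which satisfies $\lambda(rs) = \lambda(sr)$ for all $r,s \in R$. *)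

(* Defs.v *)
From HB Require Import structures.
From mathcomp Require Import all_boot all_algebra.

Set Implicit Arguments.
Unset Strict Implicit.
Unset Printing Implicit Defensive.

Import GRing.Theory.
Local Open Scope ring_scope.

(* A k-algebra structure on the ring R: a unital ring homomorphism k -> Z(R). *)
Record algebra_structure (k : fieldType) (R : pzRingType) := AlgebraStructure {
  structure_map :> {rmorphism k -> R};
  structure_mapC : forall a x, structure_map a * x = x * structure_map a }.

(* The ring R viewed as a k-algebra; the alias carries the k-module structure,
   so that R itself may be an algebra over several fields at once. R may be the
   zero ring, hence there is no algType instance, which needs a nonzero ring. *)
Definition algebra_of (k : fieldType) (R : pzRingType)
  (phi : algebra_structure k R) : Type := R.

Section AlgebraOf.
Variables (k : fieldType) (R : pzRingType) (phi : algebra_structure k R).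
Local Notation A := (algebra_of phi).

HB.instance Definition _ := GRing.PzRing.copy A R.

Definition algebra_scale (a : k) (x : A) : A := (phi a : A) * x.

Fact algebra_scaleA a b x :
  algebra_scale a (algebra_scale b x) = algebra_scale (a * b) x.
Proof. by rewrite /algebra_scale rmorphM mulrA. Qed.

Fact algebra_scale1 : left_id 1 algebra_scale.
Proof. by move=> x; rewrite /algebra_scale rmorph1 mul1r. Qed.

Fact algebra_scaleDr : right_distributive algebra_scale +%R.
Proof. by move=> a x y; rewrite /algebra_scale mulrDr. Qed.

Fact algebra_scaleDl x : {morph algebra_scale^~ x : a b / a + b}.
Proof. by move=> a b; rewrite /algebra_scale rmorphD mulrDl. Qed.

HB.instance Definition _ := GRing.Zmodule_isLmodule.Build k A
  algebra_scaleA algebra_scale1 algebra_scaleDr algebra_scaleDl.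

Fact algebra_scaleAl (a : k) (x y : A) : a *: (x * y) = (a *: x) * y.
Proof. exact: mulrA. Qed.

Fact algebra_scaleAr (a : k) (x y : A) : a *: (x * y) = x * (a *: y).
Proof.
by rewrite [LHS]mulrA [RHS]mulrA; congr (_ * y); exact: (structure_mapC phi).
Qed.

Definition finite_dimensional : Prop :=
  exists n : nat, inhabited (Vector.axiom n A).

(* {scalar A} is Hom_k(A, k), with equality of functionals taken pointwise;
   dual_lmul r f is r f and dual_rmul f r is f r. *)
Definition dual_lmul (r : A) (f : {scalar A}) : A -> k := fun s => f (s * r).
Definition dual_rmul (f : {scalar A}) (r : A) : A -> k := fun s => f (r * s).

Fact dual_lmul_scalar r f : scalar (dual_lmul r f).
Proof. by move=> a x y; rewrite /dual_lmul mulrDl -algebra_scaleAl linearP. Qed.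

Fact dual_rmul_scalar f r : scalar (dual_rmul f r).
Proof. by move=> a x y; rewrite /dual_rmul mulrDr -algebra_scaleAr linearP. Qed.

HB.instance Definition _ r f := GRing.isLinear.Build k A k _ (dual_lmul r f)
  (dual_lmul_scalar r f).
HB.instance Definition _ f r := GRing.isLinear.Build k A k _ (dual_rmul f r)
  (dual_rmul_scalar f r).

Definition dual_bimodule_iso (Phi : A -> {scalar A}) : Prop :=
  [/\ forall r s, Phi (r + s) =1 Phi r \+ Phi s,
      forall s r, Phi (s * r) =1 dual_lmul s (Phi r),
      forall r s, Phi (r * s) =1 dual_rmul (Phi r) s,
      forall r s, Phi r =1 Phi s -> r = s
    & forall f : {scalar A}, exists r, Phi r =1 f].

Definition symmetric_algebra : Prop :=
  exists Phi : A -> {scalar A}, dual_bimodule_iso Phi.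

End AlgebraOf.

(* Main.v *)
(* Let C be the center of R and lam a symmetrizing form over k1. The elements x
   with lam (C x) = 0 form a C-submodule N containing all commutators, and
   lam (C _) embeds R / N in the injective C-module Hom_k1 (C, k1); hence x
   divides y modulo N as soon as its annihilator modulo N kills y. This property
   of N no longer mentions k1. It makes isomorphic simple submodules of R / N
   equal, so one can build, one simple submodule at a time, a k2-linear form mu
   vanishing on N and on no larger C-submodule. Such a mu is symmetrizing: it
   kills the commutators, and a left ideal on which it vanishes lies in N, hence
   in the kernel of lam. *)
Require Import Defs.
From mathcomp Require Import all_boot all_algebra.
From HB Require Import structures.
From mathcomp Require Import boolp.

Set Implicit Arguments.
Unset Strict Implicit.
Unset Printing Implicit Defensive.

Import GRing.Theory.
Local Open Scope ring_scope.

(** * Subspaces, functionals and forms in finite dimension *)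

Section LinearAlgebra.
Variables (k : fieldType) (V : vectType k).

(** A subspace inside [P] can be enlarged by any vector of [P] outside it; the codimension bounds
    the number of such steps. *)
Lemma vspace_of_pred (P : V -> Prop) :
    P 0 -> (forall a x y, P x -> P y -> P (a *: x + y)) ->
  exists U : {vspace V}, forall x, P x <-> x \in U.
Proof.
move=> P0 Plin.
suff H m (U : {vspace V}) : (\dim {:V} - \dim U <= m)%N ->
    (forall x, x \in U -> P x) -> exists U : {vspace V}, forall x, P x <-> x \in U.
  by apply: (H _ 0%VS (leqnn _)) => x; rewrite memv0 => /eqP ->.
elim: m U => [|m IHm] U codimU PU.
  exists U => x; split=> [_|/PU //].
  suff -> : U = fullv by exact: memvf.
  by apply/eqP; rewrite eqEdim subvf -subn_eq0 -leqn0.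
have [[x Px Ux]|noP] := pselect (exists2 x, P x & x \notin U); last first.
  exists U => x; split=> [Px|/PU //]; apply: contrapT => /negP Ux.
  by apply: noP; exists x.
apply: (IHm (<[x]> + U)%VS).
  have ltU : (\dim U < \dim (<[x]> + U))%N.
    rewrite (ltn_leqif (dimv_leqif_sup (addvSr _ _))).
    by apply: contra Ux => /subvP; apply; rewrite memvE addvSl.
  rewrite leq_subLR in codimU; rewrite leq_subLR; apply: leq_trans codimU _.
  by rewrite addnS -addSn leq_add2r.
by move=> y /memv_addP [_ /vlineP [a ->] [u /PU Pu ->]]; apply: Plin.
Qed.

Lemma separating_functional (U : {vspace V}) (x : V) : x \notin U ->
  exists nu : {scalar V}, (forall y, y \in U -> nu y = 0) /\ nu x != 0.
Proof.
move=> Ux; pose p := (\1 - projv U)%VF.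
have pU y : y \in U -> p y = 0.
  by move=> Uy; rewrite add_lfunE opp_lfunE id_lfunE projv_id ?subrr.
have px0 : p x != 0.
  apply: contra Ux; rewrite add_lfunE opp_lfunE id_lfunE subr_eq0 => /eqP ->.
  exact: memv_proj.
have [i ci] : exists i, coord (vbasis fullv) i (p x) != 0.
  apply: contrapT => /forallNP c0; case/eqP: px0.
  rewrite (coord_vbasis (memvf (p x))) big1 // => i _.
  by have /negP/negPn/eqP -> := c0 i; rewrite scale0r.
exists (coord (vbasis fullv) i \o p : {scalar V}).
by split=> // y /pU /= ->; rewrite linear0.
Qed.

(** In a basis of [U] this is solvability of a linear system with the Gram matrix of [B]: a row
    killed by the cokernel lies in the row space. [B'] only encodes linearity of [B] in its first
    argument. *)
Lemma form_represents (U : {vspace V}) (B B' : V -> {scalar V}) (f : {scalar V}) :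
    (forall a c, B a c = B' c a) ->
    (forall c, c \in U -> (forall a, a \in U -> B a c = 0) -> f c = 0) ->
  exists2 a, a \in U & forall c, c \in U -> B a c = f c.
Proof.
move=> BB' fB; pose e := vbasis U.
have eU i : e`_i \in U.
  have [lti|lei] := ltnP i (\dim U).
    by apply: vbasis_mem; rewrite mem_nth // size_tuple.
  by rewrite nth_default ?mem0v // size_tuple.
pose G := \matrix_(i, j) B e`_(i : 'I_(\dim U)) e`_(j : 'I_(\dim U)).
pose g := \row_j f e`_(j : 'I_(\dim U)).
have fv (h : {scalar V}) (v : 'I_(\dim U) -> k) :
    h (\sum_(i < \dim U) v i *: e`_i) = \sum_(i < \dim U) h e`_i * v i.
  by rewrite linear_sum; apply: eq_bigr => i _; rewrite linearZ /= mulrC.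
have /submxP [a ga] : (g <= G)%MS.
  (* Column [j] of the cokernel lists the coordinates of a vector of [U] that [B] pairs to zero with
     all of [U]. *)
  rewrite submxE; apply/eqP/matrixP=> i0 j; rewrite ord1 [RHS]mxE mxE.
  under eq_bigr do rewrite mxE.
  rewrite -fv; apply: fB => [|b Ub].
    by apply: memv_suml => i _; apply: memvZ.
  rewrite (coord_vbasis Ub) BB' fv big1 // => i _; rewrite -BB' fv.
  have := mulmx_coker G => /matrixP/(_ i j); rewrite [RHS]mxE mxE.
  under eq_bigr do rewrite mxE.
  by move=> ->; rewrite mul0r.
exists (\sum_(i < \dim U) a 0 i *: e`_i); first by apply: memv_suml => i _; apply: memvZ.
move=> c Uc; rewrite (coord_vbasis Uc) !fv; apply: eq_bigr => j _; congr (_ * _).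
rewrite BB' fv; have /rowP/(_ j) := ga; rewrite !mxE => ->.
by apply: eq_bigr => i _; rewrite mxE -BB' mulrC.
Qed.

End LinearAlgebra.

Definition central (R : pzRingType) (c : R) : Prop := forall x, c * x = x * c.

Section Central.
Variable R : pzRingType.
Implicit Types c d x : R.

Lemma central0 : central (0 : R).
Proof. by move=> x; rewrite mul0r mulr0. Qed.

Lemma central1 : central (1 : R).
Proof. by move=> x; rewrite mul1r mulr1. Qed.

Lemma centralD c d : central c -> central d -> central (c + d).
Proof. by move=> cC dC x; rewrite mulrDl mulrDr cC dC. Qed.

Lemma centralM c d : central c -> central d -> central (c * d).
Proof. by move=> cC dC x; rewrite -mulrA dC mulrA cC mulrA. Qed.

End Central.

(** The largest submodule over the center inside the kernel of [lam]. *)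
Definition central_radical (k : fieldType) (R : pzRingType)
    (phi : algebra_structure k R) (lam : {scalar algebra_of phi}) (x : R) : Prop :=
  forall c : R, central c -> lam (c * x) = 0.

(** * Divisibility by central elements modulo a submodule *)

Section FiniteDimensional.
Variables (k : fieldType) (R : pzRingType) (phi : algebra_structure k R).
Variables (n : nat) (ax : Vector.axiom n (algebra_of phi)).
Local Notation A := (algebra_of phi).
HB.instance Definition _ := Lmodule_hasFinDim.Build k A ax.

Lemma central_scale (a : k) (c : A) : central c -> central (a *: c : A).
Proof. by move=> cC; apply: centralM => // x; exact: (structure_mapC phi). Qed.

(** On the center, the form [lam (a * (c * x))] has as radical the annihilator of [x] modulo the
    central radical. There [c] is sent to zero by [lam (c * y)], so some central [a] represents this
    functional. *)
Lemma central_multiple (lam : {scalar A}) (x y : A) :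
    (forall c : A, central c -> central_radical lam (c * x) ->
       central_radical lam (c * y)) ->
  exists2 a : A, central a & central_radical lam (y - a * x).
Proof.
move=> annxy.
have [C CE] : exists C : {vspace A}, forall c, central c <-> c \in C.
  apply: vspace_of_pred => [|a c d cC dC]; first exact: central0.
  by apply: centralD dC; apply: central_scale.
have [//|c Cc Bc|a Ca Ba] := form_represents (U := C)
    (B := fun a => dual_lmul x (dual_rmul lam a))
    (B' := fun c => dual_lmul (c * x) lam) (f := dual_lmul y lam).
  have cC : central c by apply/CE.
  have Nc : central_radical lam (c * x) by move=> d /CE Cd; exact: Bc.
  have := annxy c cC Nc 1 (@central1 A); by rewrite mul1r.
exists a; first exact/CE.
move=> c /[dup] cC /CE Cc; have := Ba c Cc; rewrite /= /dual_lmul /dual_rmul.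
by move=> Bac; rewrite mulrBr linearB /= -Bac [c * (a * x)]mulrA (cC a) -mulrA subrr.
Qed.

Section Cogenerator.
(** [N] is abstract because it will come from a form over another field; [N_multiple] is the trace
    of that form that survives the change of field. *)
Variable N : A -> Prop.
Hypothesis N0 : N 0.
Hypothesis ND : forall x y, N x -> N y -> N (x + y).
Hypothesis NM : forall c x, central c -> N x -> N (c * x).
Hypothesis N_multiple : forall x y : A,
  (forall c, central c -> N (c * x) -> N (c * y)) ->
  exists2 a, central a & N (y - a * x).

Let mapC (a : k) : central (phi a : A).
Proof. by move=> x; exact: (structure_mapC phi). Qed.

Let NZ a x : N x -> N (a *: x).
Proof. by apply: NM; apply: mapC. Qed.

Let NB x y : N x -> N y -> N (x - y).
Proof. by move=> Nx Ny; rewrite -scaleN1r; apply: ND => //; apply: NZ. Qed.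

(** The element found generates a simple submodule modulo [N]. As long as [c * x] does not give [x]
    back, replace [x] by [c * x]: by [N_multiple] its annihilator modulo [N] is strictly larger, so
    the process stops. *)
Lemma minimal_multiple (D : A -> Prop) :
    (forall c x, central c -> D x -> D (c * x)) ->
    (exists2 x, D x & ~ N x) ->
  exists x, [/\ D x, ~ N x & forall c, central c -> ~ N (c * x) ->
    exists2 b, central b & N (x - b * (c * x))].
Proof.
move=> DM [x0 Dx0 Nx0].
have annE x : exists U : {vspace A}, forall c, central c /\ N (c * x) <-> c \in U.
  apply: vspace_of_pred => [|a c d [cC Nc] [dC Nd]].
    by split; [exact: central0|rewrite mul0r].
  split; first by apply: centralD dC; apply: central_scale.
  by rewrite mulrDl -algebra_scaleAl; apply: ND => //; apply: NZ.
suff H m x (U : {vspace A}) : D x -> ~ N x ->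
    (forall c, central c /\ N (c * x) <-> c \in U) ->
    (\dim {:A} - \dim U <= m)%N ->
    exists x, [/\ D x, ~ N x & forall c, central c -> ~ N (c * x) ->
      exists2 b, central b & N (x - b * (c * x))].
  by have [U UE] := annE x0; apply: (H _ x0 U _ _ _ (leqnn _)).
elim: m x U => [|m IHm] x U Dx Nx UE codimU.
  have /UE [_] : 1 \in U; last by rewrite mul1r.
  suff -> : U = fullv by exact: memvf.
  by apply/eqP; rewrite eqEdim subvf -subn_eq0 -leqn0.
have [min_x|] := pselect (forall c, central c -> ~ N (c * x) ->
  exists2 b, central b & N (x - b * (c * x))); first by exists x.
move=> /existsNP [c] /not_implyP [cC] /not_implyP [Ncx Nb].
have [W WE] := annE (c * x).
apply: (IHm _ W (DM _ _ cC Dx) Ncx WE).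
have sUW : (U <= W)%VS.
  apply/subvP => d /UE [dC Nd]; apply/WE; split=> //.
  by rewrite mulrA dC -mulrA; apply: NM.
have ltUW : (\dim U < \dim W)%N.
  rewrite (ltn_leqif (dimv_leqif_sup sUW)); apply/negP => /subvP sWU.
  by apply: Nb; apply: N_multiple => d dC Nd; have /UE [] : d \in U
    by apply: sWU; apply/WE.
rewrite leq_subLR in codimU; rewrite leq_subLR; apply: leq_trans codimU _.
by rewrite addnS -addSn leq_add2r.
Qed.

(** Invariant of the induction: [U] is a center-stable subspace containing [N], and [mu] kills [N]
    but no larger submodule of [U]. It starts with [U] equal to [N] and [mu] zero. *)
Lemma cogenerating_functional : exists mu : {scalar A},
  (forall x, N x -> mu x = 0) /\ (forall x, central_radical mu x -> N x).
Proof.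
have [Nv NE] : exists U : {vspace A}, forall x, N x <-> x \in U.
  by apply: vspace_of_pred => // a x y Nx Ny; apply: ND => //; apply: NZ.
suff H m (U : {vspace A}) (mu : {scalar A}) : (\dim {:A} - \dim U <= m)%N ->
    (forall c x, central c -> x \in U -> c * x \in U) ->
    (forall x, N x -> x \in U) -> (forall x, N x -> mu x = 0) ->
    (forall x, x \in U -> central_radical mu x -> N x) ->
    exists mu : {scalar A}, (forall x, N x -> mu x = 0) /\
      (forall x, central_radical mu x -> N x).
  apply: (H _ Nv \0%R (leqnn _)) => //.
  - by move=> c x cC /NE Nx; apply/NE; apply: NM.
  - by move=> x /NE.
  - by move=> x /NE.
elim: m U mu => [|m IHm] U mu codimU UM NU muN goodU.
  exists mu; split=> // x; apply: goodU.
  suff -> : U = fullv by exact: memvf.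
  by apply/eqP; rewrite eqEdim subvf -subn_eq0 -leqn0.
have [good|] := pselect (forall x, central_radical mu x -> N x).
  by exists mu.
move=> /existsNP [x1] /not_implyP [Dx1 Nx1].
have [||x [Dx Nx min_x]] := @minimal_multiple (central_radical mu).
- move=> c x cC Dx d dC; rewrite mulrA; apply: Dx; exact: centralM.
- by exists x1.
have Ux : x \notin U by apply/negP => Ux; apply: Nx; apply: goodU.
have [nu [nuU nux]] := separating_functional Ux.
(* [W] is [U] plus the central multiples of [x]; on it [mu] gets corrected by [nu], which kills [U]
   but not [x]. *)
have [W WE] : exists W : {vspace A}, forall y,
    (exists2 c, central c & y - c * x \in U) <-> y \in W.
  apply: vspace_of_pred => [|a y z [c cC Uc] [d dC Ud]].
    by exists 0; [exact: central0|rewrite mul0r subr0 mem0v].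
  exists (a *: c + d); first by apply: centralD dC; apply: central_scale.
  rewrite mulrDl -algebra_scaleAl opprD addrACA -scalerBr.
  by apply: memvD Ud; apply: memvZ.
have sUW : (U <= W)%VS.
  apply/subvP => y Uy; apply/WE; exists 0; first exact: central0.
  by rewrite mul0r subr0.
apply: (IHm W (mu \+ nu)).
- have ltUW : (\dim U < \dim W)%N.
    rewrite (ltn_leqif (dimv_leqif_sup sUW)); apply: contra Ux => /subvP; apply.
    by apply/WE; exists 1; [exact: central1|rewrite mul1r subrr mem0v].
  rewrite leq_subLR in codimU; rewrite leq_subLR; apply: leq_trans codimU _.
  by rewrite addnS -addSn leq_add2r.
- move=> c y cC /WE [d dC Ud]; apply/WE; exists (c * d); first exact: centralM.
  by rewrite -mulrA -mulrBr; apply: UM.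
- by move=> y /NU; apply/subvP.
- by move=> y Ny; rewrite /= muN // nuU ?addr0 //; apply: NU.
have goodU' u : u \in U -> central_radical (mu \+ nu) u -> N u.
  move=> Uu Du; apply: goodU => // c cC.
  by have := Du c cC; rewrite /= (nuU (c * u)) ?addr0 //; apply: UM.
move=> y /WE [c cC Uc] Dy; apply: contrapT => Ny.
have DM d : central d -> central_radical (mu \+ nu) (d * y).
  by move=> dC e eC; rewrite mulrA; apply: Dy; apply: centralM.
(* A central [d] that takes [x] into [N] takes [y] into [U], where the radical of the corrected form
   lies in [N]. *)
have [a aC Na] : exists2 a, central a & N (y - a * x).
  apply: N_multiple => d dC Nd; apply: goodU'; last exact: DM.
  have -> : d * y = d * (y - c * x) + c * (d * x).
    by rewrite mulrBr !mulrA (cC d) subrK.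
  by apply: memvD; [apply: UM|apply: NU; apply: NM].
have Nax : ~ N (a * x).
  by move=> Nax; apply: Ny; rewrite -(subrK (a * x) y); apply: ND.
have [b bC Nb] := min_x a aC Nax.
(* Simplicity makes [x] a multiple of [y] modulo [N], so the corrected form kills [x]; but [mu x] is
   zero and [nu x] is not. *)
have Nxby : N (x - b * y).
  have -> : x - b * y = (x - b * (a * x)) - b * (y - a * x).
    by rewrite mulrBr opprB addrA subrK.
  by apply: NB => //; apply: NM.
have : (mu \+ nu) x = 0.
  rewrite -(subrK (b * y) x) linearD (Dy b bC) addr0 /=.
  by rewrite muN // nuU ?addr0 //; apply: NU.
rewrite /= -[x]mul1r Dx ?add0r ?mul1r; last exact: central1.
by move/eqP; rewrite (negPf nux).
Qed.

End Cogenerator.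

(** * Symmetrizing forms and bimodule isomorphisms *)

Lemma symmetric_of_form (mu : {scalar A}) :
    (forall r s, mu (r * s) = mu (s * r)) ->
    (forall r, (forall s, mu (s * r) = 0) -> r = 0) ->
  symmetric_algebra phi.
Proof.
move=> muC mu_nd; exists (fun r => dual_lmul r mu); split.
- by move=> r s t; rewrite /= /dual_lmul mulrDr linearD.
- by move=> s r t; rewrite /= /dual_lmul mulrA.
- by move=> r s t; rewrite /= /dual_rmul /= /dual_lmul mulrA muC mulrA.
- move=> r s rs; apply/eqP; rewrite -subr_eq0; apply/eqP; apply: mu_nd => t.
  by have := rs t; rewrite /= /dual_lmul mulrBr linearB /= => ->; rewrite subrr.
(* Surjectivity: nondegeneracy leaves no radical on which [f] would have to vanish. *)
move=> f; have [||r _ fr] := form_represents (U := fullv)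
  (B := fun r => dual_lmul r mu) (B' := fun s => dual_rmul mu s) (f := f).
- by [].
- move=> c _ Bc; rewrite (mu_nd c) ?linear0 // => s.
  by have := Bc s (memvf _); rewrite /= /dual_lmul muC.
by exists r => s; apply: fr; exact: memvf.
Qed.

End FiniteDimensional.

(** The form is the image of [1]: left linearity gives [Phi r s = Phi 1 (s * r)], right linearity
    [Phi 1 (r * s)]. *)
Lemma form_of_symmetric (k : fieldType) (R : pzRingType)
    (phi : algebra_structure k R) : symmetric_algebra phi ->
  exists lam : {scalar algebra_of phi},
    (forall r s, lam (r * s) = lam (s * r)) /\
    (forall r, (forall s, lam (s * r) = 0) -> r = 0).
Proof.
move=> [Phi [_ Phil Phir Phi_inj _]]; exists (Phi 1).
have lE r s : Phi r s = Phi 1 (s * r) by rewrite -[r in LHS]mulr1 Phil.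
split=> [r s|r r0]; first by rewrite -lE -[s in LHS]mul1r Phir.
by apply: Phi_inj => s; rewrite lE r0 (lE 0) mulr0 linear0.
Qed.

(** * Transfer from one field to the other *)

Lemma symmetric_change_field (R : pzRingType) (k1 k2 : fieldType)
    (phi1 : algebra_structure k1 R) (phi2 : algebra_structure k2 R) :
    finite_dimensional phi1 -> finite_dimensional phi2 ->
  symmetric_algebra phi1 -> symmetric_algebra phi2.
Proof.
move=> [n1 [ax1]] [n2 [ax2]] /form_of_symmetric [lam [lamC lam_nd]].
have [||||mu [muN Nmu]] := @cogenerating_functional _ _ phi2 _ ax2
  (central_radical lam).
- by move=> c _; rewrite mulr0 linear0.
- by move=> x y Nx Ny c cC; rewrite mulrDr linearD /= Nx ?Ny ?addr0.
- by move=> c x cC Nx d dC; rewrite mulrA; apply: Nx; apply: centralM.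
- exact: (central_multiple ax1).
apply: (symmetric_of_form ax2 (mu := mu)).
  move=> r s; apply/eqP; rewrite -subr_eq0 -linearB; apply/eqP.
  (* Commutators lie in the central radical of [lam]: a central factor can be moved past [s] after a
     cyclic shift. *)
  apply: muN => c cC; rewrite mulrBr linearB /=.
  suff -> : lam (c * (r * s)) = lam (c * (s * r)) by rewrite subrr.
  by rewrite mulrA lamC mulrA -(cC s) -mulrA.
move=> r mur; apply: lam_nd => s.
have Nsr : central_radical lam (s * r).
  by apply: Nmu => c cC; rewrite mulrA; apply: mur.
by have := Nsr 1 (@central1 R); rewrite mul1r.
Qed.

Theorem corollary4 (R : pzRingType) (k1 k2 : fieldType)
    (phi1 : algebra_structure k1 R) (phi2 : algebra_structure k2 R)
    (fd1 : finite_dimensional phi1) (fd2 : finite_dimensional phi2) :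
  symmetric_algebra phi1 <-> symmetric_algebra phi2.
Proof. by split; apply: symmetric_change_field. Qed.
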